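(* In the setting and notation described in the context (GKSM iteration), assume $K<+\infty$ and $0<\alpha_{\min}\le\alpha_k\le\alpha_{\max}<\frac{2\underline{\eta}}{\underline{\eta}+L}$ for all $k$; put $\upsilon:=\frac{\underline{\eta}}{\alpha_{\max}}-\frac{\underline{\eta}+L}{2}>0$. Then: (i) $\|\mathbf x_{k+1}-\mathbf x_k\|\to0$, and every cluster point $\hat{\mathbf x}$ of $\{\mathbf x_k\}$ is a critical point of $\min_{\mathbf x\in\mathcal C}F(\mathbf x)$, i.e. $\mathbf 0\in\nabla F(\hat{\mathbf x})+\partial\iota_{\mathcal C}(\hat{\mathbf x})$. (ii) Suppose moreover that $\mathbf x_k\to\mathbf x^*$ and that $F_{\mathcal C}$ satisfies the KL inequality at $\bar{\mathbf x}=\mathbf x^*$ with desingularizing function $\varphi(s)=c\,s^{1-t}$ ($c>0$, $t\in[0,1)$), constant $\eta>0$ and a neighborhood $\mathcal U$ of $\mathbf x^*$ containing a closed ball $\mathcal B(\mathbf x^*,\Lambda)$, $\Lambda>0$. Set $F^*:=F(\mathbf x^* )$. Then there exists $K'>K+1$ such that $\mathbf x_k\in\mathcal B(\mathbf x^*,\Lambda)$ and $|F_{\mathcal C}(\mathbf x_k)-F^*|<\eta$ for all $k\ge K'$, and, with $F_{K'}:=F(\mathbf x_{K'})-F^*$ and $\gamma:=\sup_k\frac{[c(L\alpha_k+\overline{\eta})]^2}{\upsilon(1-t)^2\alpha_k^2}$, the following hold for $k\ge K'$: 1. if $t=0$: $F(\mathbf x_{k+1})-F^*\le\big(F_{K'}-\tfrac{1}{\gamma}(k-K'+1)\big)_+$,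 where $(a)_+=\max(a,0)$; 2. if $t\in(0,\tfrac12]$: $F(\mathbf x_{k+1})-F^*\le\Big(1-\frac{F_{K'}^{2t-1}}{F_{K'}^{2t-1}+\gamma}\Big)^{k-K'+1}F_{K'}$; 3. if $t\in(\tfrac12,1)$: for every $\sigma\in(0,1)$ and all sufficiently large $k$, $F(\mathbf x_{k+1})-F^*\le\big(F_{K'}^{1-2t}+q\,(k-K'+1)\big)^{\frac{1}{1-2t}}$ with $q=(t-\tfrac12)(1-\sigma)^{2t}/\gamma$.
   Context: Setting. Identify $\mathbb C^N$ with $\mathbb R^{2N}$ equipped with the real inner product $\mathrm{Re}\langle\mathbf u,\mathbf v\rangle$, where $\langle\mathbf u,\mathbf v\rangle=\mathbf u^{H}\mathbf v$ ($^H$ = conjugate transpose); all gradients are taken with respect to this inner product. Let $\mathbf A\in\mathbb C^{m\times N}$, $\mathbf y\in\mathbb C^m$ with $\mathbf A^H\mathbf y\neq\mathbf 0$, and $h(\mathbf x)=\frac12\|\mathbf A\mathbf x-\mathbf y\|_2^2$ (so $\nabla h(\mathbf x)=\mathbf A^H(\mathbf A\mathbf x-\mathbf y)$). Let $f:\mathbb C^N\to\mathbb R$ be differentiable and bounded below, with $\nabla f$ $L$-Lipschitz ($L>0$): $\|\nabla f(\mathbf x_1)-\nabla f(\mathbf x_2)\|\le L\|\mathbf x_1-\mathbf x_2\|$. Let $\mathcal C\subseteq\mathbb C^N$ be nonempty, closed and convex, $\iota_{\mathcal C}$ its indicator function ($0$ on $\mathcal C$, $+\infty$ outside), $F=h+f$,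 $F_{\mathcal C}=F+\iota_{\mathcal C}$, and $\|\mathbf x\|_{\mathbf M}^2=\mathbf x^H\mathbf M\mathbf x$. GKSM iteration. Fix $K\in\{1,2,\dots\}\cup\{+\infty\}$, stepsizes $\alpha_k>0$, and Hermitian matrices $\mathbf B_k\in\mathbb C^{N\times N}$ with $\underline{\eta}\,\mathbf I\preceq\mathbf B_k\preceq\overline{\eta}\,\mathbf I$ for all $k$, where $0<\underline{\eta}\le\overline{\eta}<\infty$ (in the paper $\mathbf B_k$ is produced by a modified self-scaling Hermitian rank-one quasi-Newton rule whose output satisfies these bounds). Let $\mathbf V_1=\mathbf A^H\mathbf y/\|\mathbf A^H\mathbf y\|$ and choose $\mathbf x_1\in\mathcal C\cap\operatorname{range}(\mathbf V_1)$. For $k=1,2,\dots$: define $\bar F_k(\mathbf x)=h(\mathbf x)+\mathrm{Re}\langle\nabla f(\mathbf x_k),\mathbf x\rangle+\frac{1}{2\alpha_k}\|\mathbf x-\mathbf x_k\|_{\mathbf B_k}^2$; let $\boldsymbol\beta_k$ be the (unique) minimizer of $\boldsymbol\beta\mapsto\bar F_k(\mathbf V_k\boldsymbol\beta)$ over $\{\boldsymbol\beta:\mathbf V_k\boldsymbol\beta\in\mathcal C\}$, and set $\mathbf x_{k+1}=\mathbf V_k\boldsymbol\beta_k$. Then, if $k\le K$: compute $\mathbf r_k=\nabla\bar F_k(\mathbf x_{k+1})=\mathbf A^H(\mathbf A\mathbf x_{k+1}-\mathbf y)+\nabla f(\mathbf x_k)+\alpha_k^{-1}\mathbf B_k(\mathbf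 x_{k+1}-\mathbf x_k)$ and $\tilde{\mathbf r}_k=(\mathbf I-\mathbf V_k\mathbf V_k^H)\mathbf r_k$; if $\tilde{\mathbf r}_k\ne\mathbf 0$ set $\mathbf V_{k+1}=[\mathbf V_k,\ \tilde{\mathbf r}_k/\|\tilde{\mathbf r}_k\|]$, otherwise $\mathbf V_{k+1}=\mathbf V_k$. If $k>K$: set $\mathbf V_{k+1}=\mathbf I_N$. (Thus every $\mathbf V_k$ has orthonormal columns, $\mathbf V_k^H\mathbf V_k=\mathbf I$.) KL inequality. A proper lower semicontinuous $\chi:\mathbb C^N\to(-\infty,+\infty]$ satisfies the Kurdyka–Łojasiewicz inequality at $\bar{\mathbf x}\in\operatorname{dom}\partial\chi$ if there exist $\eta>0$, a neighborhood $\mathcal U$ of $\bar{\mathbf x}$ and a continuous concave $\varphi:[0,\eta)\to\mathbb R_+$, continuously differentiable on $(0,\eta)$, with $\varphi(0)=0$ and $\varphi'>0$ on $(0,\eta)$, such that $\varphi'(|\chi(\mathbf x)-\chi(\bar{\mathbf x})|)\cdot\operatorname{dist}(\mathbf 0,\partial\chi(\mathbf x))\ge1$ for all $\mathbf x\in\mathcal U$ with $|\chi(\mathbf x)-\chi(\bar{\mathbf x})|<\eta$. Here $\partial$ denotes the (limiting) subdifferential and $\operatorname{dist}$ the Euclidean distance. *)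

(* Defs.v *)
(* mathcomp-analysis reals + real_closed complex numbers R[i]. *)
From HB Require Import structures.
From mathcomp Require Import all_boot all_order all_algebra.
From mathcomp Require Import all_classical all_reals all_analysis.
From mathcomp Require Import complex.
Set Implicit Arguments. Unset Strict Implicit. Unset Printing Implicit Defensive.
Import Order.TTheory GRing.Theory Num.Theory numFieldNormedType.Exports.
Local Open Scope ring_scope.
Local Open Scope classical_set_scope.

Section Defs.
Variables (R : realType) (N : nat).
Local Notation C := (R[i]).
Local Notation vec := ('cV[C]_N).

(* conjugate transpose *)
Definition adj (m n : nat) (M : 'M[C]_(m, n)) : 'M[C]_(n, m) :=
  (map_mx (fun z : C => z^*) M)^T.

(* <u,v> = u^H v, real inner product Re<u,v>, Euclidean norm *)
Definition cdot (u v : vec) : C := (adj u *m v) 0 0.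
Definition rip (u v : vec) : R := complex.Re (cdot u v).
Definition normv (v : vec) : R := Num.sqrt (rip v v).

(* Hermitian matrix and Loewner bounds  etaL I <= M <= etaH I *)
Definition hermitianM (M : 'M[C]_N) := adj M = M.
Definition loewner_bounds (etaL etaH : R) (M : 'M[C]_N) :=
  forall v : vec, etaL * normv v ^+ 2 <= complex.Re (cdot v (M *m v))
               /\ complex.Re (cdot v (M *m v)) <= etaH * normv v ^+ 2.

(* (Frechet) gradient w.r.t. the real inner product Re<.,.> *)
Definition is_gradient (f : vec -> R) (g : vec -> vec) :=
  forall x (e : R), 0 < e -> exists2 d : R, 0 < d &
    forall h : vec, normv h < d ->
      `| f (x + h) - f x - rip (g x) h | <= e * normv h.

Definition lipschitzv (g : vec -> vec) (L : R) :=
  forall x1 x2, normv (g x1 - g x2) <= L * normv (x1 - x2).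

Definition closedv (S : set vec) :=
  forall x, (forall e : R, 0 < e -> exists z, S z /\ normv (z - x) < e) -> S x.

Definition convexv (S : set vec) :=
  forall u v (l : R), S u -> S v -> 0 <= l <= 1 ->
    S ((l%:C)%C *: u + ((1 - l)%:C)%C *: v).

(* indicator function of S *)
Definition indicator (S : set vec) (x : vec) : \bar R :=
  if `[< S x >] then 0%E else +oo%E.

(* convergence of vector sequences *)
Definition cvgv (u : nat -> vec) (l : vec) :=
  (fun n => normv (u n - l)) @ \oo --> (0 : R).

(* Frechet (regular) subdifferential *)
Definition frechet_subdiff (chi : vec -> \bar R) (x : vec) : set vec :=
  [set v | chi x \is a fin_num /\
    forall e : R, 0 < e -> exists2 d : R, 0 < d &
      forall z : vec, normv (z - x) < d ->
        (chi x + (rip v (z - x) - e * normv (z - x))%:E <= chi z)%E].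

(* limiting subdifferential *)
Definition subdiff (chi : vec -> \bar R) (x : vec) : set vec :=
  [set v | exists (xs vs : nat -> vec),
     [/\ cvgv xs x,
         chi x \is a fin_num,
         (fun n => fine (chi (xs n))) @ \oo --> fine (chi x),
         (forall n, frechet_subdiff chi (xs n) (vs n)) & cvgv vs v]].

(* dist(0, S) in the extended reals (+oo if S is empty) *)
Definition dist0 (S : set vec) : \bar R :=
  ereal_inf [set (normv v)%:E | v in S].

(* KL inequality at xbar with constant eta, neighborhood U, desingularizing phi *)
Definition KL_at (chi : vec -> \bar R) (xbar : vec) (eta : R) (U : set vec)
    (phi : R -> R) :=
  [/\ exists v, subdiff chi xbar v,
      exists2 r : R, 0 < r & (forall z, normv (z - xbar) < r -> U z)
    & forall x, U x ->
        (0 < `| chi x - chi xbar | < eta%:E)%E ->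
        ((derive1 phi (fine `| chi x - chi xbar |))%:E * dist0 (subdiff chi x)
           >= 1)%E].

(* matrix whose columns are the vectors of s *)
Definition colmat (s : seq vec) : 'M[C]_(N, size s) :=
  \matrix_(i < N, j < size s) (nth 0 s j) i 0.

Definition idcols : seq vec := [seq col j (1%:M : 'M[C]_N) | j <- enum 'I_N].

End Defs.

Section GKSM.
Variables (R : realType) (N m : nat).
Local Notation C := (R[i]).
Local Notation vec := ('cV[C]_N).
Variables (A : 'M[C]_(m, N)) (y : 'cV[C]_m).

(* h(x) = 1/2 ||Ax - y||^2 and its gradient A^H (Ax - y) *)
Definition hfun (x : vec) : R := 2^-1 * normv (A *m x - y) ^+ 2.
Definition gradh (x : vec) : vec := adj A *m (A *m x - y).

(* the GKSM iteration (indices k = 1, 2, ...), with data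
   f, gradf, S (= the set C), K, alpha, B, iterates x and bases V
   (V k is the list of the columns of V_k) *)
Definition GKSM (gradf : vec -> vec) (S : set vec) (K : nat)
    (alpha : nat -> R) (B : nat -> 'M[C]_N) (x : nat -> vec)
    (V : nat -> seq vec) :=
  let Fbar k (z : vec) : R :=
    hfun z + rip (gradf (x k)) z
    + (2 * alpha k)^-1 * complex.Re (cdot (z - x k) (B k *m (z - x k))) in
  [/\ V 1%N = [:: ((normv (adj A *m y))^-1)%:C%C *: (adj A *m y)],
      S (x 1%N) /\ exists b : 'cV[C]_(size (V 1%N)), x 1%N = colmat (V 1%N) *m b,
      (forall k, (1 <= k)%N ->
         exists b : 'cV[C]_(size (V k)),
           [/\ x k.+1 = colmat (V k) *m b, S (colmat (V k) *m b) &
               forall b' : 'cV[C]_(size (V k)), S (colmat (V k) *m b') ->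
                 Fbar k (colmat (V k) *m b) <= Fbar k (colmat (V k) *m b')]),
      (forall k, (1 <= k <= K)%N ->
         let r := gradh (x k.+1) + gradf (x k)
                  + ((alpha k)^-1)%:C%C *: (B k *m (x k.+1 - x k)) in
         let rt := r - colmat (V k) *m (adj (colmat (V k)) *m r) in
         V k.+1 = if rt != 0 then rcons (V k) (((normv rt)^-1)%:C%C *: rt)
                  else V k) &
      (forall k, (K < k)%N -> V k.+1 = idcols R N)].

End GKSM.

(* Main.v *)
(** Each step minimises the model [h + <gradf x_k, .> + |. - x_k|_B^2 / (2 alpha)] over a
    convex set containing [x_k].  The model is exactly quadratic, so optimality together
    with the descent lemma for [f] gives [F x_k - F x_(k+1) >= ups |x_(k+1) - x_k|^2], and
    as [F] is bounded below the steps tend to [0].  Once the subspace is the whole space,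
    minus the gradient of the model lies in the normal cone of [S] at [x_(k+1)].  That
    gradient differs from [gradF x_(k+1)] by at most [(L + etaH / alpha) |x_(k+1) - x_k|],
    so closedness of the normal cone makes cluster points critical, and the difference is a
    small subgradient of [F + indicator S].  Fed into the KL inequality, it yields for
    [s_k = F x_k - F xs] the recursion [s_(k+1)^(2t) <= gam (s_k - s_(k+1))], from which
    the three rates follow. *)
Require Import Defs.
From HB Require Import structures.
From mathcomp Require Import all_boot all_order all_algebra.
From mathcomp Require Import all_classical all_reals all_analysis.
From mathcomp Require Import complex ring lra.
Import Order.TTheory GRing.Theory Num.Theory numFieldNormedType.Exports.
Local Open Scope ring_scope.
Local Open Scope classical_set_scope.
Set Implicit Arguments. Unset Strict Implicit. Unset Printing Implicit Defensive.

Section InnerProduct.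
Variables (R : realType) (n : nat).
Local Notation C := (R[i]).
Implicit Types (u v w : 'cV[C]_n) (a : R) (z : C).

Lemma ripE u v : rip u v =
  \sum_i (complex.Re (u i 0) * complex.Re (v i 0)
          + complex.Im (u i 0) * complex.Im (v i 0)).
Proof.
rewrite /rip /cdot /adj mxE raddf_sum; apply: eq_bigr => i _; rewrite !mxE.
by case: (u i 0) => a b; case: (v i 0) => c d /=; ring.
Qed.

Lemma ripC u v : rip u v = rip v u.
Proof. by rewrite !ripE; apply: eq_bigr => i _; ring. Qed.

Lemma ripDr u v w : rip u (v + w) = rip u v + rip u w.
Proof. by rewrite /rip /cdot mulmxDr mxE raddfD. Qed.

Lemma ripDl u v w : rip (v + w) u = rip v u + rip w u.
Proof. by rewrite ripC ripDr !(ripC u). Qed.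

Lemma ripZr a u v : rip u (a%:C%C *: v) = a * rip u v.
Proof.
rewrite !ripE mulr_sumr; apply: eq_bigr => i _; rewrite mxE.
by case: (v i 0) => c d /=; ring.
Qed.

Lemma ripZl a u v : rip (a%:C%C *: u) v = a * rip u v.
Proof. by rewrite ripC ripZr ripC. Qed.

Lemma ripNr u v : rip u (- v) = - rip u v.
Proof. by rewrite /rip /cdot mulmxN mxE raddfN. Qed.

Lemma ripNl u v : rip (- u) v = - rip u v.
Proof. by rewrite ripC ripNr ripC. Qed.

Lemma rip0r u : rip u 0 = 0.
Proof. by rewrite /rip /cdot mulmx0 mxE. Qed.

Definition rip_linear := (ripDl, ripDr, ripNl, ripNr, ripZl, ripZr).

Lemma rip_ge0 u : 0 <= rip u u.
Proof. by rewrite ripE; apply: sumr_ge0 => i _; rewrite addr_ge0 // -expr2 sqr_ge0. Qed.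

Lemma normv_ge0 u : 0 <= normv u.
Proof. exact: sqrtr_ge0. Qed.

Lemma sqr_normv u : normv u ^+ 2 = rip u u.
Proof. by rewrite sqr_sqrtr ?rip_ge0. Qed.

Lemma normc_ge0 z : 0 <= Normc.normc z.
Proof. by case: z => a b; exact: sqrtr_ge0. Qed.

Lemma sqr_normvE u : normv u ^+ 2 = \sum_i Normc.normc (u i 0) ^+ 2.
Proof.
rewrite sqr_normv ripE; apply: eq_bigr => i _.
by case: (u i 0) => a b /=; rewrite sqr_sqrtr ?addr_ge0 ?sqr_ge0.
Qed.

Lemma normc_le_normv u i : Normc.normc (u i 0) <= normv u.
Proof.
rewrite -ler_sqr ?nnegrE ?normv_ge0 ?normc_ge0 // sqr_normvE.
by rewrite (bigD1 i) //= lerDl sumr_ge0 // => j _; exact: sqr_ge0.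
Qed.

Lemma normv0 : normv (0 : 'cV[C]_n) = 0.
Proof. by rewrite /normv rip0r sqrtr0. Qed.

Lemma normv0_eq0 u : normv u = 0 -> u = 0.
Proof.
move=> u0; apply/matrixP => i j; rewrite (ord1 j) mxE.
by apply: Normc.eq0_normc; apply/le_anti; rewrite normc_ge0 -u0 normc_le_normv.
Qed.

Lemma normvZ z u : normv (z *: u) = Normc.normc z * normv u.
Proof.
apply/eqP; rewrite -(@eqrXn2 _ 2) ?mulr_ge0 ?normv_ge0 ?normc_ge0 //.
rewrite exprMn !sqr_normvE mulr_sumr; apply/eqP/eq_bigr => i _.
by rewrite mxE Normc.normcM exprMn.
Qed.

Lemma normv_scaler a u : normv (a%:C%C *: u) = `|a| * normv u.
Proof. by rewrite normvZ /= expr0n addr0 sqrtr_sqr. Qed.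

Lemma normvN u : normv (- u) = normv u.
Proof. by rewrite /normv ripNl ripNr opprK. Qed.

Lemma rip_le_normv u v : rip u v <= normv u * normv v.
Proof.
have [u0|u_neq0] := eqVneq (normv u) 0.
  by rewrite (normv0_eq0 u0) ripC rip0r normv0 mul0r.
have [v0|v_neq0] := eqVneq (normv v) 0.
  by rewrite (normv0_eq0 v0) rip0r normv0 mulr0.
have uv_gt0 : 0 < normv u * normv v by rewrite mulr_gt0 // lt_def ?u_neq0 ?v_neq0 normv_ge0.
have := rip_ge0 ((normv v)%:C%C *: u - (normv u)%:C%C *: v).
rewrite !rip_linear (ripC v u) -!sqr_normv.
move: (normv u) (normv v) (rip u v) uv_gt0 => p q r pq_gt0.
rewrite (_ : _ + _ = (p * q) * (2 * (p * q - r))); last by ring.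
by rewrite pmulr_rge0 // pmulr_rge0 // subr_ge0.
Qed.

Lemma normr_rip_le u v : `|rip u v| <= normv u * normv v.
Proof. by rewrite ler_norml rip_le_normv lerNl -ripNl -(normvN u) rip_le_normv. Qed.

Lemma ler_normvD u v : normv (u + v) <= normv u + normv v.
Proof.
rewrite -(@ler_sqr _ (normv (u + v))) ?nnegrE ?addr_ge0 ?normv_ge0 //.
rewrite sqr_normv !rip_linear (ripC v u) -!sqr_normv.
have := rip_le_normv u v; move: (normv u) (normv v) (rip u v) => p q r; nra.
Qed.

Lemma ler_normvB u v : normv (u - v) <= normv u + normv v.
Proof. by rewrite -(normvN v) ler_normvD. Qed.

Lemma ler_normv_sum (I : Type) (r : seq I) (P : pred I) (F : I -> 'cV[C]_n) :
  normv (\sum_(i <- r | P i) F i) <= \sum_(i <- r | P i) normv (F i).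
Proof.
elim/big_ind2 : _ => [|u a v b ua vb|//]; first by rewrite normv0.
by rewrite (le_trans (ler_normvD _ _)) // lerD.
Qed.

End InnerProduct.

Section Adjoint.
Variable R : realType.
Local Notation C := (R[i]).
Implicit Types p q r : nat.

Lemma adjM p q r (M : 'M[C]_(p, q)) (P : 'M[C]_(q, r)) :
  adj (M *m P) = adj P *m adj M.
Proof. by rewrite /adj map_mxM trmx_mul. Qed.

Lemma adjK p q (M : 'M[C]_(p, q)) : adj (adj M) = M.
Proof. by apply/matrixP => i j; rewrite !mxE conjCK. Qed.

Lemma rip_mulmxl p q (M : 'M[C]_(p, q)) u v :
  rip (M *m u) v = rip u (adj M *m v).
Proof. by rewrite /rip /cdot adjM mulmxA. Qed.

Lemma mulmx_sum_col p q (M : 'M[C]_(p, q)) (u : 'cV[C]_q) :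
  M *m u = \sum_j u j 0 *: col j M.
Proof.
apply/matrixP => i j; rewrite (ord1 j) mxE summxE.
by apply: eq_bigr => k _; rewrite !mxE mulrC.
Qed.

Lemma normv_mulmx_bounded p q (M : 'M[C]_(p, q)) :
  exists2 b : R, 0 <= b & forall u, normv (M *m u) <= b * normv u.
Proof.
exists (\sum_j normv (col j M)) => [|u].
  by apply: sumr_ge0 => j _; exact: normv_ge0.
rewrite mulmx_sum_col mulr_suml; apply: le_trans (ler_normv_sum _ _ _) _.
apply: ler_sum => j _.
by rewrite normvZ mulrC ler_wpM2l ?normv_ge0 ?normc_le_normv.
Qed.

Lemma loewner_lower p (a b : R) (M : 'M[C]_p) v :
  loewner_bounds a b M -> a * normv v ^+ 2 <= rip v (M *m v).
Proof. by move=> /(_ v)[]. Qed.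

Lemma loewner_upper p (a b : R) (M : 'M[C]_p) v :
  loewner_bounds a b M -> rip v (M *m v) <= b * normv v ^+ 2.
Proof. by move=> /(_ v)[]. Qed.

Lemma hermitian_ripC p (M : 'M[C]_p) u v :
  hermitianM M -> rip u (M *m v) = rip v (M *m u).
Proof. by move=> herm; rewrite -{1}herm -rip_mulmxl ripC. Qed.

(* The form [rip z (M *m z)] is nonnegative at [z = M *m v - b v]. *)
Lemma loewner_normv_le p (a b : R) (M : 'M[C]_p) v :
  0 <= a -> 0 < b -> hermitianM M -> loewner_bounds a b M ->
  normv (M *m v) <= b * normv v.
Proof.
move=> a_ge0 b_gt0 herm bnd; set w := M *m v.
have : 0 <= rip (w - b%:C%C *: v) (M *m (w - b%:C%C *: v)).
  by apply: le_trans (loewner_lower _ bnd); rewrite mulr_ge0 ?sqr_ge0.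
rewrite mulmxBr -scalemxAr !rip_linear (hermitian_ripC v w herm) -/w.
rewrite -(sqr_normv w) => form_ge0.
have w_le := loewner_upper w bnd; have := loewner_upper v bnd; rewrite -/w => v_le.
rewrite -ler_sqr ?nnegrE ?mulr_ge0 ?normv_ge0 ?(ltW b_gt0) // exprMn -(ler_pM2l b_gt0).
move: (normv w ^+ 2) (normv v ^+ 2) (rip v w) (rip w (M *m w)) form_ge0 w_le v_le.
by move=> w2 v2 vw wMw form_ge0 w_le v_le; nra.
Qed.

End Adjoint.

Lemma cvgr_dist_squeeze (R : realType) (T : Type) (G : set_system T) {FG : Filter G}
    (s w : T -> R) (l : R) :
  (\forall k \near G, `|s k - l| <= w k) -> w @ G --> (0 : R) -> s @ G --> l.
Proof.
move=> sw w0; apply/cvgrPdistC_le => e e_gt0.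
apply: filterS2 sw (cvgr_lt _ w0 _ e_gt0) => k s_le w_lt.
exact: le_trans s_le (ltW w_lt).
Qed.

Section VectorSequences.
Variables (R : realType) (n : nat).
Local Notation vec := 'cV[R[i]]_n.
Implicit Types (u v : nat -> vec) (a b : vec) (S : set vec).

Lemma cvgv_squeeze u a (w : nat -> R) :
  (\forall k \near \oo, normv (u k - a) <= w k) -> w @ \oo --> (0 : R) ->
  cvgv u a.
Proof.
move=> uw; apply: cvgr_dist_squeeze; apply: filterS uw => k.
by rewrite subr0 ger0_norm ?normv_ge0.
Qed.

Lemma cvgv_lt u a (e : R) : cvgv u a -> 0 < e ->
  \forall k \near \oo, normv (u k - a) < e.
Proof. by move=> ua; exact: (cvgr_lt _ ua). Qed.

Lemma cvgvD u v a b : cvgv u a -> cvgv v b -> cvgv (fun k => u k + v k) (a + b).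
Proof.
move=> ua vb; apply: (@cvgv_squeeze _ _ (fun k => normv (u k - a) + normv (v k - b))).
  by apply: nearW => k; rewrite opprD addrACA ler_normvD.
by rewrite -[0 : R]addr0; exact: cvgD ua vb.
Qed.

Lemma cvgvN u a : cvgv u a -> cvgv (fun k => - u k) (- a).
Proof.
apply: cvgv_squeeze; apply: nearW => k.
by rewrite -opprD normvN.
Qed.

Lemma cvgvB u v a b : cvgv u a -> cvgv v b -> cvgv (fun k => u k - v k) (a - b).
Proof. by move=> ua /cvgvN; exact: cvgvD. Qed.

Lemma cvgv_cst a : cvgv (fun=> a) a.
Proof. by rewrite /cvgv subrr normv0; exact: cvg_cst. Qed.

Lemma cvgv_lipschitz (g : vec -> vec) (L : R) u a :
  lipschitzv g L -> cvgv u a -> cvgv (g \o u) (g a).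
Proof.
move=> gL ua; apply: (cvgv_squeeze (nearW _ (fun k => gL (u k) a))).
by rewrite -(mulr0 L); exact: cvgMr.
Qed.

Lemma cvg_rip u v a b : cvgv u a -> cvgv v b ->
  (fun k => rip (u k) (v k)) @ \oo --> rip a b.
Proof.
move=> ua vb.
pose w k := normv (u k - a) * normv (v k - b)
  + (normv (u k - a) * normv b + normv a * normv (v k - b)).
apply: (@cvgr_dist_squeeze _ _ _ _ _ w).
  apply: nearW => k.
  have -> : rip (u k) (v k) - rip a b = rip (u k - a) (v k - b)
      + (rip (u k - a) b + rip a (v k - b)).
    by rewrite !rip_linear !addrA; ring.
  rewrite (le_trans (ler_normD _ _)) // lerD ?normr_rip_le //.
  by rewrite (le_trans (ler_normD _ _)) // lerD ?normr_rip_le.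
rewrite [X in _ --> X](_ : _ = 0 * 0 + (0 * normv b + normv a * 0)); last first.
  by rewrite !mul0r mulr0 !addr0.
exact: cvgD (cvgM ua vb) (cvgD (cvgMl ua) (cvgMr vb)).
Qed.

Lemma closedv_limit S u a :
  closedv S -> (\forall k \near \oo, S (u k)) -> cvgv u a -> S a.
Proof.
move=> Scl Su ua; apply: Scl => e e_gt0.
have [k [Suk uk_lt]] := filter_ex (filterI Su (cvgv_lt ua e_gt0)).
by exists (u k).
Qed.

Definition cluster_pt u a := forall (e : R) (k0 : nat), 0 < e ->
  exists2 k, (k0 <= k)%N & normv (u k - a) < e.

Lemma cluster_pt_subseq u a : cluster_pt u a ->
  exists2 s : nat -> nat, s @ \oo --> \oo & cvgv (u \o s) a.
Proof.
move=> ua.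
have near_a j : exists k, (j <= k)%N /\ normv (u k - a) < harmonic j.
  by have [k jk uk] := ua (harmonic j) j (harmonic_gt0 j); exists k.
have [s sP] := choice near_a; exists s.
  apply/cvgnyPge => j0; near=> j.
  by apply: leq_trans (proj1 (sP j)); near: j; exact: nbhs_infty_ge.
by apply: cvgv_squeeze cvg_harmonic; apply: nearW => j; exact/ltW/(proj2 (sP j)).
Unshelve. all: by end_near. Qed.

End VectorSequences.

Section Gradient.
Variables (R : realType) (n : nat).
Local Notation vec := 'cV[R[i]]_n.
Implicit Types (f : vec -> R) (g : vec -> vec) (x d z : vec).

Lemma is_gradient_quadratic_error f g (b : R) : 0 <= b ->
  (forall x d, `|f (x + d) - f x - rip (g x) d| <= b * normv d ^+ 2) ->
  is_gradient f g.
Proof.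
move=> b_ge0 fg x e e_gt0; have b1_gt0 : 0 < b + 1 by rewrite ltr_wpDl.
exists (e / (b + 1)) => [|d]; first by rewrite divr_gt0.
rewrite ltr_pdivlMr // => d_lt; apply: le_trans (fg x d) _.
rewrite expr2 mulrA ler_wpM2r ?normv_ge0 // (le_trans _ (ltW d_lt)) // mulrC.
by rewrite ler_wpM2l ?normv_ge0 // lerDl.
Qed.

Lemma is_gradientD f1 g1 f2 g2 : is_gradient f1 g1 -> is_gradient f2 g2 ->
  is_gradient (fun z => f1 z + f2 z) (fun z => g1 z + g2 z).
Proof.
move=> fg1 fg2 x e e_gt0; have e2_gt0 : 0 < e / 2 by rewrite divr_gt0.
have [r1 r1_gt0 err1] := fg1 x _ e2_gt0; have [r2 r2_gt0 err2] := fg2 x _ e2_gt0.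
exists (Num.min r1 r2) => [|d]; first by rewrite lt_min r1_gt0.
rewrite lt_min => /andP[/err1 le1 /err2 le2]; rewrite ripDl.
rewrite (_ : _ - _ = (f1 (x + d) - f1 x - rip (g1 x) d)
  + (f2 (x + d) - f2 x - rip (g2 x) d)); last by ring.
apply: le_trans (ler_normD _ _) _; apply: le_trans (lerD le1 le2) _.
by rewrite -mulrDl -splitr.
Qed.

Lemma lipschitzvD g1 g2 (L1 L2 : R) :
  lipschitzv g1 L1 -> lipschitzv g2 L2 ->
  lipschitzv (fun z => g1 z + g2 z) (L1 + L2).
Proof.
move=> g1L g2L x z; rewrite opprD addrACA mulrDl.
by rewrite (le_trans (ler_normvD _ _)) // lerD.
Qed.

Lemma is_gradient_cvg f g (u : nat -> vec) x :
  is_gradient f g -> cvgv u x -> (fun k => f (u k)) @ \oo --> f x.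
Proof.
move=> fg ux; have [r r_gt0 err] := fg x 1 ltr01.
apply: (@cvgr_dist_squeeze _ _ _ _ _ (fun k => (1 + normv (g x)) * normv (u k - x))).
  apply: filterS (cvgv_lt ux r_gt0) => k /err; rewrite [x + _]addrC subrK => err_k.
  rewrite -[f _ - _](subrK (rip (g x) (u k - x))) mulrDl.
  by rewrite (le_trans (ler_normD _ _)) // lerD ?normr_rip_le.
by rewrite -(mulr0 (1 + normv (g x))); exact: cvgMr.
Qed.

Lemma is_derive_line f g x d (s : R) : is_gradient f g ->
  is_derive s 1 (fun r => f (x + r%:C%C *: d)) (rip (g (x + s%:C%C *: d)) d).
Proof.
move=> fg; set F := fun r : R => _; set xs := x + _; set l := rip _ d.
suff cvF : (fun h => h^-1 *: ((F \o shift s) (h *: 1) - F s)) @ 0^' --> l.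
  by apply: DeriveDef; [apply/cvg_ex; exists l|exact: cvg_lim cvF].
apply/cvgrPdistC_le => e e_gt0.
have d1_gt0 : 0 < normv d + 1 by rewrite ltr_wpDl ?normv_ge0.
have [r r_gt0 err] := fg xs _ (divr_gt0 e_gt0 d1_gt0).
near=> h.
have h_neq0 : h != 0 by near: h; exact: nbhs_dnbhs_neq.
have h_lt : `|h| < r / (normv d + 1).
  by near: h; apply: dnbhs0_lt; rewrite divr_gt0.
have hd_le : `|h| * normv d <= `|h| * (normv d + 1) by rewrite ler_wpM2l // lerDl.
have hd_lt : normv (h%:C%C *: d) < r.
  by rewrite normv_scaler (le_lt_trans hd_le) // -ltr_pdivlMr.
have -> : (F \o shift s) (h *: 1) = f (xs + h%:C%C *: d).
  by rewrite /F /xs /= [h *: 1]mulr1 rmorphD scalerDl addrA addrAC.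
have err_h : `|f (xs + h%:C%C *: d) - F s - h * l| <= e / (normv d + 1) * (`|h| * normv d).
  by rewrite -ripZr -normv_scaler; exact: err.
move: (f (xs + _)) (F s) err_h => q p err_h.
have -> : h^-1 *: (q - p) - l = h^-1 * (q - p - h * l).
  by rewrite [RHS]mulrBr mulrA mulVf // mul1r.
rewrite normrM normfV mulrC ler_pdivrMr ?normr_gt0 //; apply: le_trans err_h _.
by rewrite mulrAC ler_pdivrMr // -mulrA ler_wpM2l ?(ltW e_gt0).
Unshelve. all: by end_near. Qed.

Lemma lipschitz_gradient_le f g (L : R) x d :
  is_gradient f g -> lipschitzv g L ->
  f (x + d) <= f x + rip (g x) d + L / 2 * normv d ^+ 2.
Proof.
move=> fg gL.
pose F (s : R) := f (x + s%:C%C *: d).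
pose p (s : R) := - (rip (g x) d * s + L / 2 * normv d ^+ 2 * s ^+ 2).
pose dF (s : R) := rip (g (x + s%:C%C *: d)) d
   + - (rip (g x) d + L * normv d ^+ 2 * s).
have F_derive (s : R) : is_derive s 1 (F + p : R -> R) (dF s).
  apply: is_deriveD; first exact: is_derive_line.
  apply: is_deriveN.
  by apply: is_derive_eq; rewrite /GRing.scale /=; field.
have [|s /itvP s01] := @MVT R _ _ 0 1 ltr01 (fun s _ => F_derive s).
  apply: continuous_subspaceT => s; apply: differentiable_continuous.
  by apply/derivable1_diffP; have [] := F_derive s.
rewrite subr0 mulr1 !fctE /F /p rmorph0 rmorph1 scale0r addr0 scale1r => FE.
suff : dF s <= 0 by move: FE; lra.
have s_ge0 : 0 <= s by rewrite s01.
have gL_s : normv (g (x + s%:C%C *: d) - g x) <= L * (s * normv d).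
  by have := gL (x + s%:C%C *: d) x; rewrite addrAC subrr add0r normv_scaler ger0_norm.
rewrite /dF opprD addrA -ripNl -ripDl subr_le0 (le_trans (rip_le_normv _ _)) //.
apply: le_trans (ler_wpM2r (normv_ge0 d) gL_s) _.
by rewrite (_ : L * (s * normv d) * normv d = L * normv d ^+ 2 * s) //; ring.
Qed.

End Gradient.

Section NormalCone.
Variables (R : realType) (n : nat).
Local Notation vec := 'cV[R[i]]_n.
Implicit Types (S T : set vec) (f : vec -> R) (g : vec -> vec) (x v w z : vec).

Definition normal_cone S x : set vec :=
  [set v | S x /\ forall z, S z -> rip v (z - x) <= 0].

Lemma normal_cone_closed S (u v : nat -> vec) x w : closedv S ->
  cvgv u x -> cvgv v w -> (\forall k \near \oo, normal_cone S (u k) (v k)) ->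
  normal_cone S x w.
Proof.
move=> Scl ux vw uv; split.
  by apply: closedv_limit Scl _ ux; apply: filterS uv => k [].
move=> z Sz; have rip_cvg := cvg_rip vw (cvgvB (cvgv_cst z) ux).
rewrite -(cvg_lim _ rip_cvg) //; apply: limr_le; first exact: cvgP rip_cvg.
by apply: filterS uv => k [_]; exact.
Qed.

Lemma convexv_segment S x z (l : R) : convexv S -> S x -> S z -> 0 <= l <= 1 ->
  S (x + l%:C%C *: (z - x)).
Proof.
move=> Scv Sx Sz l01; have := Scv _ _ _ Sz Sx l01.
by rewrite rmorphB rmorph1 scalerBl scale1r scalerBr addrCA.
Qed.

Lemma convexvI S T : convexv S -> convexv T -> convexv (S `&` T).
Proof.
move=> Scv Tcv u v l [Su Tu] [Sv Tv] l01.
by split; [exact: Scv|exact: Tcv].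
Qed.

Lemma argmin_normal_cone f g S x : is_gradient f g -> convexv S -> S x ->
  (forall z, S z -> f x <= f z) -> normal_cone S x (- g x).
Proof.
move=> fg Scv Sx x_min; split=> // z Sz; rewrite ripNl oppr_le0.
have [dF dFE] := is_derive_line x (z - x) 0 fg.
move: dFE; rewrite scale0r addr0 => <-; rewrite /derive.
have cvF := cvg_dnbhs_at_right dF.
rewrite -(cvg_lim _ cvF) //; apply: limr_ge; first exact: cvgP cvF.
near=> h.
have h_gt0 : 0 < h by near: h; exact: nbhs_right_gt.
have h_le1 : h <= 1 by near: h; apply: nbhs_right_le.
rewrite /= addr0 scale0r addr0 mulr_ge0 ?invr_ge0 ?(ltW h_gt0) // subr_ge0.
by apply/x_min/(convexv_segment Scv Sx Sz); rewrite [h%:A]mulr1 (ltW h_gt0).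
Unshelve. all: by end_near. Qed.

End NormalCone.

Section LeastSquares.
Variables (R : realType) (n m : nat) (A : 'M[R[i]]_(m, n)) (y : 'cV[R[i]]_m).
Implicit Types x d : 'cV[R[i]]_n.

Lemma hfunD x d : hfun A y (x + d)
  = hfun A y x + rip (gradh A y x) d + 2^-1 * normv (A *m d) ^+ 2.
Proof.
rewrite /hfun /gradh (mulmxDr A x) (addrAC (A *m x)) rip_mulmxl adjK.
move: (A *m x - y) (A *m d) => p q; rewrite !sqr_normv !rip_linear (ripC q p).
by move: (rip p p) (rip p q) (rip q q) => pp pq qq; field.
Qed.

Lemma hfun_ge0 x : 0 <= hfun A y x.
Proof. by rewrite mulr_ge0 ?sqr_ge0 ?invr_ge0. Qed.

Lemma objective_lbounded (f : 'cV[R[i]]_n -> R) : (exists lb, forall x, lb <= f x) ->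
  exists lb, forall x, lb <= hfun A y x + f x.
Proof. by move=> [lb f_lb]; exists lb => x; rewrite -[lb]add0r lerD ?hfun_ge0. Qed.

Lemma is_gradient_hfun : is_gradient (hfun A y) (gradh A y).
Proof.
have [b b_ge0 A_le] := normv_mulmx_bounded A.
apply: (@is_gradient_quadratic_error _ _ _ _ (2^-1 * b ^+ 2)) => [|x d].
  by rewrite mulr_ge0 ?sqr_ge0 ?invr_ge0.
rewrite hfunD -addrA -opprD addrAC subrr add0r.
rewrite ger0_norm ?mulr_ge0 ?normv_ge0 ?invr_ge0 // -mulrA ler_wpM2l ?invr_ge0 //.
by rewrite -exprMn ler_sqr ?nnegrE ?mulr_ge0 ?normv_ge0.
Qed.

Lemma gradh_lipschitz : exists b : R, lipschitzv (gradh A y) b.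
Proof.
have [b _ A_le] := normv_mulmx_bounded (adj A *m A).
by exists b => x z; rewrite /gradh -mulmxBr opprB addrA subrK -mulmxBr mulmxA.
Qed.

End LeastSquares.

Section ColumnSpan.
Variables (R : realType) (n : nat).
Local Notation vec := 'cV[R[i]]_n.
Implicit Types (W : seq vec) (v z : vec).

Definition colspan W : set vec := range (mulmx (colmat W)).

Lemma colspan0 W : colspan W 0.
Proof. by exists 0 => //; exact: mulmx0. Qed.

Lemma colspanD W v z : colspan W v -> colspan W z -> colspan W (v + z).
Proof. by move=> [b _ <-] [b' _ <-]; exists (b + b') => //; exact: mulmxDr. Qed.

Lemma colspanZ W a v : colspan W v -> colspan W (a *: v).
Proof. by move=> [b _ <-]; exists (a *: b) => //; rewrite -scalemxAr. Qed.

Lemma colspan_sum W k (c : 'I_k -> R[i]) (v : 'I_k -> vec) :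
  (forall j, colspan W (v j)) -> colspan W (\sum_j c j *: v j).
Proof.
move=> Wv; elim/big_ind : _ => [|u z|j _]; first exact: colspan0.
  exact: colspanD.
exact: colspanZ.
Qed.

Lemma mem_colspan W v : v \in W -> colspan W v.
Proof.
move=> vW; have ltW : (index v W < size W)%N by rewrite index_mem.
exists (delta_mx (Ordinal ltW) 0) => //; rewrite -colE.
by apply/matrixP => i j; rewrite (ord1 j) !mxE nth_index.
Qed.

Lemma colspan_subset W W' : {subset W <= W'} -> colspan W `<=` colspan W'.
Proof.
move=> WW' _ [b _ <-]; rewrite mulmx_sum_col; apply: colspan_sum => j.
rewrite (_ : col j _ = W`_j); first exact/mem_colspan/WW'/mem_nth.
by apply/matrixP => i k; rewrite (ord1 k) !mxE.
Qed.

Lemma colspan_idcols z : colspan (idcols R n) z.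
Proof.
rewrite -[z]mul1mx mulmx_sum_col; apply: colspan_sum => j.
by apply/mem_colspan/map_f; rewrite mem_enum.
Qed.

Lemma convexv_colspan W : convexv (colspan W).
Proof. by move=> u v l Wu Wv _; apply: colspanD; exact: colspanZ. Qed.

End ColumnSpan.

Section ProximalModel.
Variables (R : realType) (n m : nat) (A : 'M[R[i]]_(m, n)) (y : 'cV[R[i]]_m).
Local Notation vec := 'cV[R[i]]_n.
Implicit Types (p xk w d : vec) (a : R) (M : 'M[R[i]]_n).

Definition prox_model p xk a M (z : vec) : R :=
  hfun A y z + rip p z + (2 * a)^-1 * complex.Re (cdot (z - xk) (M *m (z - xk))).

Definition prox_grad p xk a M (z : vec) : vec :=
  gradh A y z + p + (a^-1)%:C%C *: (M *m (z - xk)).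

Lemma prox_modelD p xk a M w d : hermitianM M ->
  prox_model p xk a M (w + d) = prox_model p xk a M w
    + rip (prox_grad p xk a M w) d
    + (2^-1 * normv (A *m d) ^+ 2 + (2 * a)^-1 * rip d (M *m d)).
Proof.
move=> herm; rewrite /prox_model /prox_grad hfunD -!/(rip _ _) (addrAC w d).
move: (w - xk) => e; rewrite mulmxDr !rip_linear (hermitian_ripC e d herm) invfM.
rewrite (ripC (M *m e)).
move: (hfun A y w) (rip (gradh A y w) d) (rip p w) (rip p d) => h hd pw pd.
move: (rip e (M *m e)) (rip d (M *m e)) (rip d (M *m d)) => ee de dd.
by move: (_ ^+ 2) a^-1 => Ad ai; field.
Qed.

Lemma is_gradient_prox_model p xk a M : 0 < a -> hermitianM M ->
  is_gradient (prox_model p xk a M) (prox_grad p xk a M).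
Proof.
move=> a_gt0 herm.
have [b b_ge0 A_le] := normv_mulmx_bounded A.
have [c c_ge0 M_le] := normv_mulmx_bounded M.
have a2_ge0 : 0 <= (2 * a)^-1 by rewrite invr_ge0 mulr_ge0 // ltW.
apply: (@is_gradient_quadratic_error _ _ _ _ (2^-1 * b ^+ 2 + (2 * a)^-1 * c)) => [|w d].
  by rewrite addr_ge0 ?mulr_ge0 // invr_ge0.
rewrite prox_modelD // -addrA -opprD addrAC subrr add0r.
rewrite (le_trans (ler_normD _ _)) // [leRHS]mulrDl lerD //.
  rewrite ger0_norm ?mulr_ge0 ?normv_ge0 ?invr_ge0 // -mulrA -exprMn ler_wpM2l ?invr_ge0 //.
  by rewrite ler_sqr ?nnegrE ?mulr_ge0 ?normv_ge0.
rewrite normrM (ger0_norm a2_ge0) -mulrA ler_wpM2l //.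
by rewrite (le_trans (normr_rip_le _ _)) // expr2 mulrCA ler_wpM2l ?normv_ge0.
Qed.

Lemma prox_step_hfun_le p xk a M w : 0 <= rip (prox_grad p xk a M w) (xk - w) ->
  hfun A y w + rip p (w - xk) + a^-1 * rip (w - xk) (M *m (w - xk))
    <= hfun A y xk.
Proof.
have := hfunD A y w (xk - w); rewrite [w + _]addrC subrK => ->.
rewrite /prox_grad -(opprB w xk); move: (w - xk) => d.
rewrite !rip_linear (ripC (M *m d)) => opt.
apply: ler_wpDr; first by rewrite mulr_ge0 ?sqr_ge0 ?invr_ge0.
by move: (hfun A y w) (rip (gradh A y w) d) (rip p d) (a^-1 * _) opt => *; lra.
Qed.

Lemma prox_step_decrease (f : vec -> R) (g : vec -> vec) (L a lo hi : R) M
    (T : set vec) xk w :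
  is_gradient f g -> lipschitzv g L -> 0 < a -> loewner_bounds lo hi M ->
  T xk -> normal_cone T w (- prox_grad (g xk) xk a M w) ->
  (lo / a - L / 2) * normv (w - xk) ^+ 2
    <= (hfun A y xk + f xk) - (hfun A y w + f w).
Proof.
move=> fg gL a_gt0 bnd Txk [_ /(_ _ Txk)].
rewrite ripNl oppr_le0 => /prox_step_hfun_le h_le.
have f_le := lipschitz_gradient_le xk (w - xk) fg gL; rewrite [xk + _]addrC subrK in f_le.
have M_ge : lo / a * normv (w - xk) ^+ 2 <= a^-1 * rip (w - xk) (M *m (w - xk)).
  by rewrite mulrAC mulrC ler_wpM2l ?invr_ge0 ?(ltW a_gt0) ?(loewner_lower _ bnd).
rewrite mulrBl; move: (lo / a * _) (a^-1 * _) (L / 2 * _) M_ge h_le f_le.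
by move: (rip _ _) (hfun A y w) (hfun A y xk) (f w) (f xk) => *; lra.
Qed.

Lemma prox_residual_le (g : vec -> vec) (L a lo hi : R) M xk w :
  lipschitzv g L -> 0 < a -> 0 <= lo -> 0 < hi -> hermitianM M ->
  loewner_bounds lo hi M ->
  normv (gradh A y w + g w - prox_grad (g xk) xk a M w)
    <= (L + hi / a) * normv (w - xk).
Proof.
move=> gL a_gt0 lo_ge0 hi_gt0 herm bnd.
rewrite /prox_grad opprD addrA opprD addrACA subrr add0r.
rewrite (le_trans (ler_normvB _ _)) // mulrDl lerD //.
rewrite normv_scaler ger0_norm ?invr_ge0 ?(ltW a_gt0) // mulrAC mulrC.
by rewrite ler_wpM2r ?invr_ge0 ?(ltW a_gt0) ?(loewner_normv_le _ lo_ge0).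
Qed.

End ProximalModel.

Section Subdifferential.
Variables (R : realType) (n : nat).
Local Notation vec := 'cV[R[i]]_n.
Implicit Types (S : set vec) (F : vec -> R) (chi : vec -> \bar R) (x v : vec).

Lemma frechet_subdiff_sub chi x : frechet_subdiff chi x `<=` subdiff chi x.
Proof.
move=> v xv; exists (fun=> x), (fun=> v); split=> //.
- exact: cvgv_cst.
- by case: xv.
- exact: cvg_cst.
- exact: cvgv_cst.
Qed.

Lemma indicator_in S x : S x -> indicator S x = 0%E.
Proof. by move=> Sx; rewrite /indicator asboolT. Qed.

Lemma indicator_notin S x : ~ S x -> indicator S x = +oo%E.
Proof. by move=> Sx; rewrite /indicator asboolF. Qed.

Lemma normal_cone_sub_frechet S x :
  normal_cone S x `<=` frechet_subdiff (indicator S) x.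
Proof.
move=> v [Sx v_le]; split; first by rewrite indicator_in.
move=> e e_gt0; exists 1 => // z _; rewrite indicator_in // add0e.
have [Sz|nSz] := pselect (S z); last by rewrite indicator_notin ?leey.
rewrite indicator_in // lee_fin subr_le0 (le_trans (v_le _ Sz)) //.
by rewrite mulr_ge0 ?normv_ge0 // ltW.
Qed.

Lemma frechet_subdiffDl F g chi x v : is_gradient F g ->
  frechet_subdiff chi x v ->
  frechet_subdiff (fun z => ((F z)%:E + chi z)%E) x (g x + v).
Proof.
move=> Fg [chi_fin chi_ge]; split=> [|e e_gt0]; first by rewrite fin_numD.
have e2_gt0 : 0 < e / 2 by rewrite divr_gt0.
have [r1 r1_gt0 F_err] := Fg x _ e2_gt0.
have [r2 r2_gt0 {}chi_ge] := chi_ge _ e2_gt0.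
exists (Num.min r1 r2) => [|z]; first by rewrite lt_min r1_gt0.
rewrite lt_min => /andP[/F_err + /chi_ge {}chi_ge].
rewrite [x + _]addrC subrK ler_norml => /andP[F_ge _].
apply: le_trans (leeD2l (F z)%:E chi_ge).
rewrite -(fineK chi_fin) -!EFinD lee_fin ripDl; move: F_ge.
by move: (normv _) (rip (g x) _) (rip v _) => *; lra.
Qed.

Lemma KL_powR_le chi xbar eta U (c t s : R) x v :
  KL_at chi xbar eta U (fun r => c * r `^ (1 - t)) ->
  0 <= c -> t <= 1 -> U x -> (chi x - chi xbar)%E = s%:E -> 0 < s < eta ->
  subdiff chi x v -> s `^ t <= c * (1 - t) * normv v.
Proof.
move=> [_ _ KL] c_ge0 t_le1 Ux sE /andP[s_gt0 s_lt] vx.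
have := KL _ Ux; rewrite sE /= (gtr0_norm s_gt0) !lte_fin s_gt0 s_lt => /(_ isT).
have phi_derive : is_derive s 1 (c \*: (@powR R ^~ (1 - t))) (c * ((1 - t) * s `^ (1 - t - 1))).
  by apply: is_deriveZ; exact: is_derive1_powR.
rewrite derive1E (@derive_val _ _ _ _ _ _ _ phi_derive) => KL_x.
have {KL_x} : 1 <= c * ((1 - t) * s `^ (1 - t - 1)) * normv v.
  rewrite -lee_fin EFinM; apply: le_trans KL_x _; apply: lee_wpmul2l.
    by rewrite lee_fin !mulr_ge0 ?powR_ge0 // subr_ge0.
  by apply: ereal_inf_lbound; exists v.
have -> : 1 - t - 1 = - t by ring.
rewrite powRN -(ler_pM2l (powR_gt0 t s_gt0)) mulr1 => /le_trans; apply.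
by rewrite (_ : s `^ t * _ = c * (1 - t) * normv v) //; field; rewrite gt_eqF ?powR_gt0.
Qed.

End Subdifferential.

Section RealPowers.
Variable R : realType.
Implicit Types r x y p gam sigma : R.

Lemma le0_ler_powR r x y : r <= 0 -> 0 < x -> x <= y -> y `^ r <= x `^ r.
Proof.
move=> r_le0 x_gt0 xy; have y_gt0 := lt_le_trans x_gt0 xy.
rewrite -[r]opprK !(powRN _ (- r)) lef_pV2 ?posrE ?powR_gt0 //.
by apply: ge0_ler_powR; rewrite ?nnegrE ?oppr_ge0 ?(ltW x_gt0) ?(ltW y_gt0).
Qed.

Lemma powRK r x : r != 0 -> 0 <= x -> (x `^ r) `^ (1 / r) = x.
Proof. by move=> r0 x_ge0; rewrite -powRrM div1r divff // powRr1. Qed.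

Lemma powRVK r x : r != 0 -> 0 <= x -> (x `^ (1 / r)) `^ r = x.
Proof. by move=> r0 x_ge0; rewrite -powRrM div1r mulVf // powRr1. Qed.

Lemma powRN_Bernoulli r x : 0 <= r -> 0 < x -> 1 + r * (1 - x) <= x `^ (- r).
Proof.
move=> r_ge0 x_gt0; rewrite /powR gt_eqF //.
apply: le_trans (expR_ge1Dx _); rewrite lerD2l mulNr -mulrN ler_wpM2l //.
rewrite -[x in ln x](subrK 1) [_ + 1]addrC lerNr opprB.
by apply: le_ln1Dx; rewrite ltrBrDl subrr.
Qed.

Lemma powR_short_step_gain p gam sigma x y : 1 <= p -> 0 < gam -> sigma <= 1 ->
  0 < x -> 0 < y -> (1 - sigma) * x <= y -> y `^ p <= gam * (x - y) ->
  x `^ (1 - p) + (p - 1) * (1 - sigma) `^ p / gam <= y `^ (1 - p).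
Proof.
move=> p_ge1 gam_gt0 sigma_le1 x_gt0 y_gt0 xy rec.
have p1_ge0 : 0 <= p - 1 by rewrite subr_ge0.
have yE : y = x * (y / x) by rewrite mulrC divfK ?gt_eqF.
rewrite {1}yE powRM ?divr_ge0 ?(ltW x_gt0) ?(ltW y_gt0) // -[1 - p]opprB.
apply: le_trans (ler_wpM2l (powR_ge0 _ _) (powRN_Bernoulli p1_ge0 (divr_gt0 y_gt0 x_gt0))).
rewrite mulrDr mulr1 lerD2l mulrCA -mulrA ler_wpM2l // ler_pdivrMr //.
rewrite opprB powRB ?(gt_eqF x_gt0) ?implybT // powRr1 ?(ltW x_gt0) //.
have -> : x / x `^ p * (1 - y / x) * gam = gam * (x - y) / x `^ p.
  by field; rewrite !gt_eqF ?powR_gt0.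
rewrite ler_pdivlMr ?powR_gt0 // -powRM ?(ltW x_gt0) ?subr_ge0 //.
apply: le_trans rec; apply: ge0_ler_powR => //; first exact: le_trans p_ge1.
  by rewrite nnegrE mulr_ge0 ?subr_ge0 // ltW.
by rewrite nnegrE ltW.
Qed.

Lemma powR_long_step_gain p sigma x y : 1 <= p -> sigma < 1 -> 0 < x -> 0 < y ->
  y <= (1 - sigma) * x ->
  (1 - sigma) `^ (1 - p) * x `^ (1 - p) <= y `^ (1 - p).
Proof.
move=> p_ge1 sigma_lt1 x_gt0 y_gt0 yx.
by rewrite -powRM ?subr_ge0 ?(ltW sigma_lt1) ?(ltW x_gt0) // le0_ler_powR // subr_le0.
Qed.

Lemma cvg0_powR_pinfty r (s : nat -> R) : r < 0 -> (forall k, 0 < s k) ->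
  s @ \oo --> (0 : R) -> s k `^ r @[k --> \oo] --> +oo.
Proof.
move=> r_lt0 s_gt0 s_cvg0; apply/cvgryPgey; near=> M.
have M_gt0 : 0 < M by near: M; exact: nbhs_pinfty_gt.
apply: filterS (cvgr_lt _ s_cvg0 _ (powR_gt0 (1 / r) M_gt0)) => k s_lt.
rewrite -[M](powRVK (ltr0_neq0 r_lt0) (ltW M_gt0)).
by apply: le0_ler_powR; rewrite ?s_gt0 // ltW.
Unshelve. all: by end_near. Qed.

Lemma eventual_linear_growth (u : nat -> R) (q : R) : 0 <= q -> (forall k, u 0%N <= u k) ->
  (\forall k \near \oo, u k + q <= u k.+1) ->
  \forall k \near \oo, u 0%N + q / 2 * k%:R <= u k.
Proof.
move=> q_ge0 u_ge [n _ u_step].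
have growth j : u n + q * j%:R <= u (n + j)%N.
  elim: j => [|j IH]; first by rewrite mulr0 addr0 addn0.
  rewrite addnS; apply: le_trans (u_step _ (leq_addr _ _)).
  by rewrite -natr1 mulrDr mulr1 addrA lerD2r.
exists (n + n)%N => // k /= kn; rewrite -(subnKC (leq_trans (leq_addr n n) kn)).
apply: le_trans (growth _); rewrite lerD // -mulrA ler_wpM2l // natrD.
have : (n%:R : R) <= (k - n)%:R by rewrite ler_nat leq_subRL ?(leq_trans _ kn) ?leq_addr.
by move: (n%:R) ((k - n)%:R) => *; lra.
Qed.

End RealPowers.

Section PowRRecursion.
Variables (R : realType) (p gam : R) (s : nat -> R).

Definition powR_recursion := forall k, 0 < s k.+1 ->
  s k.+1 `^ p <= gam * (s k - s k.+1).

Hypothesis gam_gt0 : 0 < gam.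
Hypothesis s_ge0 : forall k, 0 <= s k.
Hypothesis s_rec : powR_recursion.

Lemma powR_recursion_nonincreasing : {homo s : i j / (i <= j)%N >-> j <= i}.
Proof.
apply/nonincreasing_seqP => k; have [s_le0|s_gt0] := leP (s k.+1) 0.
  exact: le_trans s_le0 (s_ge0 k).
by rewrite -subr_ge0 -(pmulr_rge0 _ gam_gt0) (le_trans _ (s_rec s_gt0)) ?powR_ge0.
Qed.

Lemma powR_recursion_finite : p = 0 ->
  forall k, s k <= Num.max (s 0%N - gam^-1 * k%:R) 0.
Proof.
move=> p0; elim=> [|k IH]; first by rewrite mulr0 subr0 le_max lexx.
have [s_le0|s_gt0] := leP (s k.+1) 0; first by rewrite le_max s_le0 orbT.
have := s_rec s_gt0; rewrite p0 powRr0 mulrC -ler_pdivrMr // div1r => step.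
have sk_gt0 : 0 < s k := lt_le_trans s_gt0 (powR_recursion_nonincreasing (leqnSn k)).
move: IH; rewrite !le_max (leNgt (s k) 0) sk_gt0 orbF => IH.
by rewrite -natr1 mulrDr mulr1; apply/orP; left; lra.
Qed.

Lemma powR_recursion_linear : 0 < p <= 1 -> forall k,
  s k <= (1 - s 0%N `^ (p - 1) / (s 0%N `^ (p - 1) + gam)) ^+ k * s 0%N.
Proof.
move=> /andP[p_gt0 p_le1]; set w := s 0%N `^ (p - 1).
have w_ge0 : 0 <= w := powR_ge0 _ _.
have wg_gt0 : 0 < w + gam by rewrite ltr_wpDl.
have -> : 1 - w / (w + gam) = gam / (w + gam) by field; rewrite gt_eqF.
have r_ge0 : 0 <= gam / (w + gam) by rewrite divr_ge0 ?ltW.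
have contract k : s k.+1 <= gam / (w + gam) * s k.
  have [s_le0|s_gt0] := leP (s k.+1) 0; first exact: le_trans s_le0 (mulr_ge0 r_ge0 (s_ge0 k)).
  have w_le : w <= s k.+1 `^ (p - 1).
    by rewrite le0_ler_powR ?subr_le0 // powR_recursion_nonincreasing.
  have := le_trans (ler_wpM2l (ltW s_gt0) w_le); rewrite mulr_powRB1 ?(ltW s_gt0) //.
  move=> /(_ _ (s_rec s_gt0)) rec.
  by rewrite mulrAC ler_pdivlMr // mulrDr -lerBrDr (mulrC _ gam) -mulrBr.
elim=> [|k IH]; first by rewrite mul1r.
by rewrite exprS -mulrA (le_trans (contract k)) // ler_wpM2l.
Qed.

(* Each step either keeps [s k.+1 >= (1 - sigma) * s k], and then [s k `^ (1 - p)] gains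
   at least [q], or multiplies [s k `^ (1 - p)] by a factor greater than [1], which gains
   more than [q] once [s k] is small. *)
Lemma powR_recursion_sublinear (sigma : R) : 1 < p -> 0 < sigma < 1 ->
  s @ \oo --> (0 : R) ->
  let q := (p - 1) * (1 - sigma) `^ p / gam in
  \forall k \near \oo, s k <= (s 0%N `^ (1 - p) + q / 2 * k%:R) `^ (1 / (1 - p)).
Proof.
move=> p_gt1 /andP[sigma_gt0 sigma_lt1] s_cvg0 q.
have s_noninc := powR_recursion_nonincreasing.
have [[n sn0]|s_neq0] := pselect (exists n, s n = 0).
  exists n => // k /= /s_noninc; rewrite sn0 => /le_trans; apply.
  exact: powR_ge0.
have s_gt0 k : 0 < s k.
  by rewrite lt_def s_ge0 andbT; apply/eqP => sk0; apply: s_neq0; exists k.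
have q_ge0 : 0 <= q by rewrite divr_ge0 ?mulr_ge0 ?powR_ge0 ?subr_ge0 ?ltW.
have p1_lt0 : 1 - p < 0 by rewrite subr_lt0.
pose w := (1 - sigma) `^ (1 - p).
have w_gt1 : 1 < w.
  rewrite /w -[1 - p]opprB; have p1_gt0 : 0 < p - 1 by rewrite subr_gt0.
  apply: lt_le_trans (powRN_Bernoulli (ltW p1_gt0) _); last by rewrite subr_gt0.
  by rewrite ltrDl mulr_gt0 // opprB addrC subrK.
have gain : \forall k \near \oo, s k `^ (1 - p) + q <= s k.+1 `^ (1 - p).
  have /cvgryPge/(_ (q / (w - 1))) := cvg0_powR_pinfty p1_lt0 s_gt0 s_cvg0.
  apply: filterS => k.
  rewrite ler_pdivrMr ?subr_gt0 // => q_le.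
  have [long|/ltW short] := leP (s k.+1) ((1 - sigma) * s k).
    apply: le_trans (powR_long_step_gain (ltW p_gt1) sigma_lt1 (s_gt0 k) _ long) => //.
    by rewrite -/w; lra.
  exact: (powR_short_step_gain (ltW p_gt1) gam_gt0 (ltW sigma_lt1)) (s_rec _).
have u_ge k : s 0%N `^ (1 - p) <= s k `^ (1 - p) by rewrite le0_ler_powR ?(ltW p1_lt0) ?s_noninc.
apply: filterS (eventual_linear_growth q_ge0 u_ge gain) => k u_lower.
rewrite -{1}(powRK (ltr0_neq0 p1_lt0) (s_ge0 k)) le0_ler_powR ?div1r ?invr_le0 ?(ltW p1_lt0) //.
exact: ltr_pwDl (powR_gt0 _ (s_gt0 0%N)) (mulr_ge0 (divr_ge0 q_ge0 (ler0n _ 2)) (ler0n _ k)).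
Qed.

End PowRRecursion.

Definition KL_rates (R : realType) (t gam : R) (gap : nat -> R) (k1 : nat) :=
  [/\ t = 0 -> forall k, (k1 <= k)%N ->
        gap k.+1 <= Num.max (gap k1 - gam^-1 * (k - k1).+1%:R) 0,
      0 < t <= 2^-1 -> forall k, (k1 <= k)%N ->
        gap k.+1 <= (1 - gap k1 `^ (2 * t - 1) / (gap k1 `^ (2 * t - 1) + gam))
          ^+ (k - k1).+1 * gap k1 &
      2^-1 < t < 1 -> forall sigma : R, 0 < sigma < 1 ->
        let q := (t - 2^-1) * (1 - sigma) `^ (2 * t) / gam in
        exists k2, forall k, (k2 <= k)%N -> (k1 <= k)%N ->
          gap k.+1 <= (gap k1 `^ (1 - 2 * t) + q * (k - k1).+1%:R) `^ (1 / (1 - 2 * t))].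

Lemma powR_recursion_KL_rates (R : realType) (t gam : R) (gap : nat -> R) (k1 : nat) :
  0 < gam -> (forall k, (k1 <= k)%N -> 0 <= gap k) -> gap @ \oo --> (0 : R) ->
  powR_recursion (2 * t) gam (fun j => gap (k1 + j)%N) -> KL_rates t gam gap k1.
Proof.
move=> gam_gt0 gap_ge0 gap_cvg0; set s := fun j => _ => s_rec.
have s_ge0 j : 0 <= s j by rewrite gap_ge0 ?leq_addr.
have gapE k : (k1 <= k)%N -> gap k.+1 = s (k - k1).+1.
  by move=> k1k; rewrite /s addnS subnKC.
rewrite /KL_rates (_ : gap k1 = s 0%N); last by rewrite /s addn0.
split=> [t0 k /gapE -> | /andP[t_gt0 t_le] k /gapE -> |].
- by apply: (powR_recursion_finite gam_gt0 s_ge0 s_rec); rewrite t0 mulr0.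
- by apply: (powR_recursion_linear gam_gt0 s_ge0 s_rec); lra.
move=> /andP[t_gt _] sigma sigma01; have p_gt1 : 1 < 2 * t by lra.
have s_cvg0 : s @ \oo --> (0 : R) by exact: cvg_comp (cvg_addnl k1) gap_cvg0.
have [k2 _ s_le] := powR_recursion_sublinear gam_gt0 s_ge0 s_rec p_gt1 sigma01 s_cvg0.
exists (k1 + k2)%N => k k12 /gapE ->.
have -> : (t - 2^-1) * (1 - sigma) `^ (2 * t) / gam
    = (2 * t - 1) * (1 - sigma) `^ (2 * t) / gam / 2.
  by field; rewrite gt_eqF.
by apply: s_le; rewrite /= leqW // leq_subRL ?(leq_trans _ k12) ?leq_addr.
Qed.

Lemma sufficient_decrease_cvg0 (R : realType) (s w : nat -> R) (a lb : R) :
  0 < a -> (forall k, lb <= s k) -> (forall k, a * w k ^+ 2 <= s k - s k.+1) ->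
  w @ \oo --> (0 : R).
Proof.
move=> a_gt0 s_lb dec; have s_cvg : cvgn s.
  apply: nonincreasing_is_cvgn; last by exists lb => _ [k _ <-].
  apply/nonincreasing_seqP => k.
  by rewrite -subr_ge0 (le_trans _ (dec k)) // mulr_ge0 ?sqr_ge0 // ltW.
have diff_cvg0 : (fun k => s k - s k.+1) @ \oo --> (0 : R).
  rewrite -(subrr (limn s)); apply: cvgB => //.
  by rewrite (cvg_shiftS s).
apply/cvgr0Pnorm_lt => e e_gt0.
have ae2_gt0 : 0 < a * e ^+ 2 by rewrite mulr_gt0 ?exprn_gt0.
apply: filterS (cvgr_lt _ diff_cvg0 _ ae2_gt0) => k diff_lt.
rewrite -ltr_sqr ?nnegrE ?(ltW e_gt0) // real_normK ?num_real // -(ltr_pM2l a_gt0).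
exact: le_lt_trans (dec k) diff_lt.
Qed.

Section DescentSequence.
Variables (R : realType) (n : nat).
Local Notation vec := 'cV[R[i]]_n.
Variables (F : vec -> R) (gradF : vec -> vec) (S : set vec).
Variables (k0 : nat) (a : R) (b : nat -> R) (x v : nat -> vec).

Definition sufficient_decrease := forall k, (k0 <= k)%N ->
  a * normv (x k.+1 - x k) ^+ 2 <= F (x k) - F (x k.+1).

(* The first conjunct makes [v k] a subgradient of [F + indicator S] at [x k.+1]. *)
Definition relative_error := forall k, (k0 <= k)%N ->
  normal_cone S (x k.+1) (v k - gradF (x k.+1)) /\
  normv (v k) <= b k * normv (x k.+1 - x k).

Hypothesis F_grad : is_gradient F gradF.
Hypothesis a_gt0 : 0 < a.
Hypothesis decrease : sufficient_decrease.

Lemma descent_nonincreasing j k : (k0 <= j)%N -> (j <= k)%N -> F (x k) <= F (x j).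
Proof.
move=> k0j /subnKC <-; elim: (k - j)%N => [|i IH]; first by rewrite addn0.
rewrite addnS -subr_ge0 (le_trans _ (lerB IH (lexx _))) //.
rewrite (le_trans _ (decrease (leq_trans k0j (leq_addr _ _)))) //.
by rewrite mulr_ge0 ?sqr_ge0 // ltW.
Qed.

Lemma descent_step_cvg0 : (exists lb, forall z, lb <= F z) ->
  (fun k => normv (x k.+1 - x k)) @ \oo --> (0 : R).
Proof.
move=> [lb F_lb]; rewrite -(cvg_shiftn k0).
apply: (sufficient_decrease_cvg0 a_gt0 (fun k => F_lb (x (k + k0)%N))) => k.
exact: decrease (leq_addl _ _).
Qed.

Lemma descent_limit_le xs k : cvgv x xs -> (k0 <= k)%N -> F xs <= F (x k).
Proof.
move=> x_cvg k0k; have F_cvg := is_gradient_cvg F_grad x_cvg.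
rewrite -(cvg_lim _ F_cvg) //; apply: limr_le; first exact: cvgP F_cvg.
by exists k => // j; exact: descent_nonincreasing.
Qed.

Hypothesis S_closed : closedv S.
Hypothesis error : relative_error.

Lemma descent_feasible k : (k0 < k)%N -> S (x k).
Proof. by case: k => // k k0k; have [[]] := error k0k. Qed.

Lemma descent_cluster_normal (L bmax : R) xh : lipschitzv gradF L ->
  (forall k, (k0 <= k)%N -> b k <= bmax) -> (exists lb, forall z, lb <= F z) ->
  cluster_pt x xh -> normal_cone S xh (- gradF xh).
Proof.
move=> gradF_lip b_le F_lb /cluster_pt_subseq[sub sub_oo xsub].
have step_cvg0 : cvgv ((fun k => x k.+1 - x k) \o sub) 0.
  rewrite /cvgv; under eq_fun do rewrite subr0.
  exact: cvg_comp sub_oo (descent_step_cvg0 F_lb).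
have sub_ge : \forall j \near \oo, (k0 <= sub j)%N by exact: (cvgnyPge sub).1 sub_oo k0.
have v_cvg0 : cvgv (v \o sub) 0.
  apply: (@cvgv_squeeze _ _ _ _ (fun j => bmax * normv (x (sub j).+1 - x (sub j)))).
    apply: filterS sub_ge => j k0j; have [_ v_le] := error k0j.
    by rewrite subr0 (le_trans v_le) // ler_wpM2r ?normv_ge0 ?b_le.
  rewrite -(mulr0 bmax); apply: cvgMr.
  exact: cvg_comp sub_oo (descent_step_cvg0 F_lb).
have xsubS : cvgv (fun j => x (sub j).+1) xh.
  rewrite -[xh]add0r; move: (cvgvD step_cvg0 xsub) => /=.
  by under eq_fun do rewrite subrK.
rewrite -[- _]add0r.
apply: normal_cone_closed xsubS (cvgvB v_cvg0 (cvgv_lipschitz gradF_lip xsubS)) _ => //.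
by apply: filterS sub_ge => j k0j; have [] := error k0j.
Qed.

Section KLRecursion.
Variables (xs : vec) (c t eta gam : R) (U : set vec).
Hypothesis x_cvg : cvgv x xs.
Hypothesis c_ge0 : 0 <= c.
Hypothesis t_le1 : t <= 1.
Hypothesis gam_ge : forall k, (k0 <= k)%N -> (c * (1 - t) * b k) ^+ 2 <= a * gam.
Hypothesis F_KL : KL_at (fun z => ((F z)%:E + indicator S z)%E) xs eta U
  (fun s => c * s `^ (1 - t)).

Lemma descent_limit_feasible : S xs.
Proof.
apply: closedv_limit x_cvg => //.
by exists k0.+1 => // k; exact: descent_feasible.
Qed.

Lemma descent_KL_step k : (k0 <= k)%N -> U (x k.+1) ->
  0 < F (x k.+1) - F xs < eta ->
  (F (x k.+1) - F xs) `^ (2 * t) <= gam * (F (x k) - F (x k.+1)).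
Proof.
move=> k0k Ux s_bounds; have [v_normal v_le] := error k0k.
have v_sub : subdiff (fun z => ((F z)%:E + indicator S z)%E) (x k.+1) (v k).
  rewrite -[v k](subrK (gradF (x k.+1))) addrC.
  exact/frechet_subdiff_sub/frechet_subdiffDl/normal_cone_sub_frechet.
have value_gap : ((F (x k.+1))%:E + indicator S (x k.+1)
    - ((F xs)%:E + indicator S xs))%E = (F (x k.+1) - F xs)%:E.
  by rewrite !indicator_in ?adde0 //; [exact: descent_limit_feasible|case: v_normal].
have := KL_powR_le F_KL c_ge0 t_le1 Ux value_gap s_bounds v_sub.
set s := F (x k.+1) - F xs; set d := normv (x k.+1 - x k) => s_le.
have {}s_le : s `^ t <= c * (1 - t) * b k * d.
  by rewrite (le_trans s_le) // -(mulrA _ (b k)) ler_wpM2l ?mulr_ge0 ?subr_ge0.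
rewrite mulrC powRrM powR_mulrn ?powR_ge0 //.
have sqr_s_le : (s `^ t) ^+ 2 <= gam * (a * d ^+ 2).
  apply: (@le_trans _ _ ((c * (1 - t) * b k * d) ^+ 2)).
    by rewrite ler_sqr ?nnegrE ?(le_trans (powR_ge0 _ _) s_le) ?powR_ge0.
  by rewrite exprMn mulrA (mulrC gam) ler_wpM2r ?sqr_ge0 ?gam_ge.
have gam_ge0 : 0 <= gam.
  by rewrite -(pmulr_rge0 _ a_gt0) (le_trans _ (gam_ge k0k)) ?sqr_ge0.
by rewrite (le_trans sqr_s_le) // ler_wpM2l ?decrease.
Qed.

Lemma descent_KL_recursion k1 : (k0 <= k1)%N ->
  (forall k, (k1 <= k)%N -> U (x k) /\ `|F (x k) - F xs| < eta) ->
  powR_recursion (2 * t) gam (fun j => F (x (k1 + j)%N) - F xs).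
Proof.
move=> k01 x_near j; rewrite addnS => s_gt0.
have [Ux s_lt] := x_near (k1 + j).+1 (leqW (leq_addr _ _)).
rewrite gtr0_norm // in s_lt; rewrite opprB addrA subrK descent_KL_step ?s_gt0 //.
exact: leq_trans k01 (leq_addr _ _).
Qed.

Lemma descent_near_limit (r : R) : 0 < r -> 0 < eta ->
  exists2 k1, (k0 < k1)%N &
    forall k, (k1 <= k)%N -> normv (x k - xs) <= r /\ `|F (x k) - F xs| < eta.
Proof.
move=> r_gt0 eta_gt0; have F_cvg := is_gradient_cvg F_grad x_cvg.
have [n1 _ x_near] := cvgv_lt x_cvg r_gt0.
have [n2 _ F_near] := cvgr_distC_lt _ _ F_cvg _ eta_gt0.
exists (maxn k0.+1 (maxn n1 n2)) => [|k]; first by rewrite leq_maxl.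
by rewrite !geq_max => /and3P[_ /x_near /ltW ? /F_near].
Qed.

Lemma descent_KL_rates k1 : (k0 <= k1)%N -> 0 < gam ->
  (forall k, (k1 <= k)%N -> U (x k) /\ `|F (x k) - F xs| < eta) ->
  KL_rates t gam (fun k => F (x k) - F xs) k1.
Proof.
move=> k01 gam_gt0 x_near.
apply: powR_recursion_KL_rates (descent_KL_recursion k01 x_near) => // [k k1k|].
  by rewrite subr_ge0 (descent_limit_le x_cvg) // (leq_trans k01).
by rewrite -(subrr (F xs)); exact: cvgB (is_gradient_cvg F_grad x_cvg) (cvg_cst _).
Qed.

End KLRecursion.

End DescentSequence.

Section KLRateConstant.
Variables (R : realType) (L etaH ups c t : R).

Definition KL_rate_const (al : R) :=
  (c * (L * al + etaH)) ^+ 2 / (ups * (1 - t) ^+ 2 * al ^+ 2).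

Hypothesis L_ge0 : 0 <= L.
Hypothesis etaH_gt0 : 0 < etaH.
Hypothesis ups_gt0 : 0 < ups.
Hypothesis c_gt0 : 0 < c.
Hypothesis t01 : 0 <= t < 1.

Let t1_gt0 : 0 < 1 - t.
Proof. by case/andP: t01 => _; rewrite subr_gt0. Qed.

Lemma KL_rate_constE al : 0 < al ->
  KL_rate_const al = (c * (L + etaH / al)) ^+ 2 / (ups * (1 - t) ^+ 2).
Proof. by move=> al_gt0; rewrite /KL_rate_const; field; rewrite !gt_eqF. Qed.

Lemma KL_rate_const_gt0 al : 0 < al -> 0 < KL_rate_const al.
Proof.
move=> al_gt0; have num_gt0 : 0 < c * (L * al + etaH).
  by rewrite mulr_gt0 // ltr_wpDl // mulr_ge0 // ltW.
by rewrite divr_gt0 ?exprn_gt0 // !mulr_gt0 ?exprn_gt0.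
Qed.

Lemma KL_rate_const_antitone al be : 0 < al -> al <= be ->
  KL_rate_const be <= KL_rate_const al.
Proof.
move=> al_gt0 al_le; have be_gt0 := lt_le_trans al_gt0 al_le.
have quot_ge0 r : 0 < r -> 0 <= L + etaH / r.
  by move=> r_gt0; rewrite addr_ge0 // divr_ge0 // ltW.
rewrite !KL_rate_constE // ler_wpM2r ?invr_ge0 ?mulr_ge0 ?(ltW ups_gt0) ?(ltW t1_gt0) //.
rewrite ler_sqr ?nnegrE ?mulr_ge0 ?quot_ge0 ?(ltW c_gt0) // ler_wpM2l ?(ltW c_gt0) //.
by rewrite lerD2l ler_wpM2l ?(ltW etaH_gt0) // lef_pV2.
Qed.

Lemma sqr_KL_error_le al : 0 < al ->
  (c * (1 - t) * (L + etaH / al)) ^+ 2 <= ups * KL_rate_const al.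
Proof.
move=> al_gt0; rewrite KL_rate_constE // mulrAC exprMn.
have -> : ups * ((c * (L + etaH / al)) ^+ 2 / (ups * (1 - t) ^+ 2))
    = (c * (L + etaH / al)) ^+ 2 / (1 - t) ^+ 2.
  by move: (c * _) => r; field; rewrite !gt_eqF.
have t1_le1 : (1 - t) ^+ 2 <= 1.
  by rewrite exprn_ile1 ?(ltW t1_gt0) // gerBl; case/andP: t01.
rewrite ler_wpM2l ?sqr_ge0 // (le_trans t1_le1) //.
by rewrite invf_ge1 ?exprn_gt0.
Qed.

Section StepsizesBoundedBelow.
Variables (alpha : nat -> R) (D : set nat) (amin : R).
Hypothesis amin_gt0 : 0 < amin.
Hypothesis amin_le : forall j, D j -> amin <= alpha j.

Let sup_ge k : D k ->
  KL_rate_const (alpha k) <= sup [set KL_rate_const (alpha j) | j in D].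
Proof.
move=> Dk; apply: ub_le_sup; last by exists k.
exists (KL_rate_const amin) => _ [j Dj <-].
exact: KL_rate_const_antitone amin_gt0 (amin_le Dj).
Qed.

Lemma sup_KL_rate_const_gt0 : D !=set0 ->
  0 < sup [set KL_rate_const (alpha j) | j in D].
Proof.
move=> [k Dk]; apply: lt_le_trans (sup_ge Dk).
exact: KL_rate_const_gt0 (lt_le_trans amin_gt0 (amin_le Dk)).
Qed.

Lemma sqr_KL_error_le_sup k : D k ->
  (c * (1 - t) * (L + etaH / alpha k)) ^+ 2
    <= ups * sup [set KL_rate_const (alpha j) | j in D].
Proof.
move=> Dk; apply: le_trans (sqr_KL_error_le (lt_le_trans amin_gt0 (amin_le Dk))) _.
by rewrite ler_wpM2l ?(ltW ups_gt0) ?sup_ge.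
Qed.

End StepsizesBoundedBelow.

End KLRateConstant.

Section GKSMConvergence.
Variables (R : realType) (N m : nat) (A : 'M[R[i]]_(m, N)) (y : 'cV[R[i]]_m).
Local Notation vec := 'cV[R[i]]_N.
Variables (f : vec -> R) (gradf : vec -> vec) (L : R) (S : set vec) (K : nat).
Variables (alpha : nat -> R) (B : nat -> 'M[R[i]]_N) (etaL etaH amin amax : R).
Variables (x : nat -> vec) (V : nat -> seq vec).
Hypothesis f_grad : is_gradient f gradf.
Hypothesis L_gt0 : 0 < L.
Hypothesis gradf_lip : lipschitzv gradf L.
Hypothesis f_lb : exists lb, forall z, lb <= f z.
Hypothesis S_closed : closedv S.
Hypothesis S_convex : convexv S.
Hypothesis etaL_gt0 : 0 < etaL.
Hypothesis etaLH : etaL <= etaH.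
Hypothesis B_bounds : forall k, (1 <= k)%N ->
  hermitianM (B k) /\ loewner_bounds etaL etaH (B k).
Hypothesis amin_gt0 : 0 < amin.
Hypothesis amax_lt : amax < 2 * etaL / (etaL + L).
Hypothesis alpha_bounds : forall k, (1 <= k)%N -> amin <= alpha k <= amax.
Hypothesis gksm : GKSM A y gradf S K alpha B x V.

Local Notation F := (fun z => hfun A y z + f z).
Local Notation gradF := (fun z => gradh A y z + gradf z).
Local Notation ups := (etaL / amax - (etaL + L) / 2).
Local Notation model_grad k :=
  (prox_grad A y (gradf (x k)) (x k) (alpha k) (B k) (x k.+1)).

Let etaH_gt0 : 0 < etaH := lt_le_trans etaL_gt0 etaLH.

Let alpha_ge k : (1 <= k)%N -> amin <= alpha k.
Proof. by move=> /alpha_bounds/andP[]. Qed.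

Let alpha_gt0 k : (1 <= k)%N -> 0 < alpha k.
Proof. by move=> /alpha_ge; exact: lt_le_trans. Qed.

Let F_grad : is_gradient F gradF := is_gradientD (is_gradient_hfun A y) f_grad.

Lemma gksm_margin_gt0 : 0 < ups.
Proof.
have /andP[_ amax_ge] := alpha_bounds (leqnn 1).
have amax_gt0 := lt_le_trans (alpha_gt0 (leqnn 1)) amax_ge.
have sum_gt0 : 0 < etaL + L by rewrite addr_gt0.
rewrite subr_gt0 ltr_pdivlMr // mulrAC ltr_pdivrMr //.
by move: amax_lt; rewrite ltr_pdivlMr // (mulrC amax) (mulrC 2).
Qed.

Lemma gksm_feasible k : (1 <= k)%N -> (S `&` colspan (V k)) (x k).
Proof.
have [_ [S1 [b1 x1E]] step extend full] := gksm.
case: k => // k _; elim: k => [|k _]; first by split=> //; exists b1.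
have [b [xE Sb _]] := step k.+1 isT; split; first by rewrite xE.
have xV : colspan (V k.+1) (x k.+2) by exists b.
have [kK|Kk] := leqP k.+1 K; last by rewrite full //; exact: colspan_idcols.
rewrite extend //=; case: ifP => // _; apply: colspan_subset xV => z zV.
by rewrite mem_rcons inE zV orbT.
Qed.

Lemma gksm_normal_cone k : (1 <= k)%N ->
  normal_cone (S `&` colspan (V k)) (x k.+1) (- model_grad k).
Proof.
move=> k_ge1; have [_ _ step _ _] := gksm; have [b [xE Sb b_min]] := step k k_ge1.
have [herm _] := B_bounds k_ge1; apply: argmin_normal_cone.
- exact: (is_gradient_prox_model _ _ _ _ (alpha_gt0 k_ge1) herm).
- exact: convexvI S_convex (@convexv_colspan _ _ _).
- by rewrite xE; split=> //; exists b.
- by move=> z [Sz [b' _ b'E]]; rewrite xE -b'E; apply: b_min; rewrite b'E.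
Qed.

Lemma gksm_normal_cone_full k : (K.+2 <= k)%N -> normal_cone S (x k.+1) (- model_grad k).
Proof.
case: k => // k Kk; have [[Sx _] normal] := gksm_normal_cone (ltn0Sn k).
split=> // z Sz; apply: normal; split=> //.
by have [_ _ _ _ full] := gksm; rewrite full //; exact: colspan_idcols.
Qed.

Lemma gksm_sufficient_decrease : sufficient_decrease F 1 ups x.
Proof.
move=> k k_ge1; have [_ bnd] := B_bounds k_ge1; have /andP[_ alpha_le] := alpha_bounds k_ge1.
apply: le_trans (prox_step_decrease f_grad gradf_lip (alpha_gt0 k_ge1) bnd
  (gksm_feasible k_ge1) (gksm_normal_cone k_ge1)).
rewrite ler_wpM2r ?sqr_ge0 //.
have : etaL / amax <= etaL / alpha k.
  by rewrite ler_wpM2l ?(ltW etaL_gt0) // lef_pV2 ?posrE ?(lt_le_trans _ alpha_le) ?alpha_gt0.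
by move: (etaL / amax) (etaL / alpha k) etaL_gt0 => *; lra.
Qed.

Lemma gksm_relative_error :
  relative_error gradF S K.+2 (fun k => L + etaH / alpha k) x
    (fun k => gradF (x k.+1) - model_grad k).
Proof.
move=> k Kk; have k_ge1 : (1 <= k)%N by exact: leq_trans Kk.
have [herm bnd] := B_bounds k_ge1; split.
  by rewrite addrC addKr; exact: gksm_normal_cone_full.
exact: prox_residual_le gradf_lip (alpha_gt0 k_ge1) (ltW etaL_gt0) etaH_gt0 herm bnd.
Qed.

Let decrease : sufficient_decrease F K.+2 ups x.
Proof. by move=> k Kk; apply: gksm_sufficient_decrease; exact: leq_trans Kk. Qed.

Lemma gksm_step_cvg0 : (fun k => normv (x k.+1 - x k)) @ \oo --> (0 : R).
Proof. exact: descent_step_cvg0 gksm_margin_gt0 decrease (objective_lbounded A y f_lb). Qed.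

Lemma gksm_cluster_normal xh : cluster_pt x xh -> normal_cone S xh (- gradF xh).
Proof.
have [Lh gradh_lip] := gradh_lipschitz A y.
apply: (descent_cluster_normal gksm_margin_gt0 decrease S_closed gksm_relative_error
  (lipschitzvD gradh_lip gradf_lip) (bmax := L + etaH / amin)).
  move=> k Kk; have k_ge1 : (1 <= k)%N by exact: leq_trans Kk.
  by rewrite lerD2l ler_wpM2l ?(ltW etaH_gt0) // lef_pV2 ?posrE ?alpha_gt0 ?alpha_ge.
exact: objective_lbounded f_lb.
Qed.

Lemma gksm_KL_rates xs (c t eta r : R) (U : set vec) :
  cvgv x xs -> 0 < c -> 0 <= t < 1 -> 0 < eta -> 0 < r ->
  (forall z, normv (z - xs) <= r -> U z) ->
  KL_at (fun z => ((F z)%:E + indicator S z)%E) xs eta U (fun s => c * s `^ (1 - t)) ->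
  let gam := sup [set KL_rate_const L etaH ups c t (alpha k) | k in [set k | (1 <= k)%N]] in
  exists2 K' : nat, (K.+2 < K')%N &
    (forall k, (K' <= k)%N -> normv (x k - xs) <= r /\
      (`|(F (x k))%:E + indicator S (x k) - (F xs)%:E| < eta%:E)%E) /\
    KL_rates t gam (fun k => F (x k) - F xs) K'.
Proof.
move=> x_cvg c_gt0 t01 eta_gt0 r_gt0 ballU F_KL gam.
have t_le1 : t <= 1 by case/andP: t01 => _ /ltW.
have gam_gt0 : 0 < gam.
  exact: (sup_KL_rate_const_gt0 (ltW L_gt0) etaH_gt0 gksm_margin_gt0 c_gt0 t01
    amin_gt0 alpha_ge (ex_intro _ 1%N isT)).
have gam_ge k : (K.+2 <= k)%N ->
    (c * (1 - t) * (L + etaH / alpha k)) ^+ 2 <= ups * gam.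
  move=> Kk; apply: (sqr_KL_error_le_sup (ltW L_gt0) etaH_gt0 gksm_margin_gt0 c_gt0 t01
    amin_gt0 alpha_ge); exact: leq_trans Kk.
have [K' K'_gt x_near] := descent_near_limit K.+2 F_grad x_cvg r_gt0 eta_gt0.
exists K' => //; split=> [k K'k|].
  have [x_ball F_near] := x_near k K'k; split=> //.
  have Sx := descent_feasible gksm_relative_error (leq_trans K'_gt K'k).
  by rewrite indicator_in // adde0 -EFinB lte_fin.
apply: (descent_KL_rates F_grad gksm_margin_gt0 decrease S_closed gksm_relative_error
  x_cvg (ltW c_gt0) t_le1 gam_ge F_KL (ltnW K'_gt) gam_gt0).
by move=> k /x_near[/ballU].
Qed.

End GKSMConvergence.

Theorem theorem2 (R : realType) (N m : nat)
  (A : 'M[R[i]]_(m, N)) (y : 'cV[R[i]]_m)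
  (f : 'cV[R[i]]_N -> R) (gradf : 'cV[R[i]]_N -> 'cV[R[i]]_N) (L : R)
  (S : set 'cV[R[i]]_N) (K : nat) (alpha : nat -> R) (B : nat -> 'M[R[i]]_N)
  (etaL etaH amin amax : R)
  (x : nat -> 'cV[R[i]]_N) (V : nat -> seq 'cV[R[i]]_N) :
  adj A *m y != 0 ->
  is_gradient f gradf ->
  0 < L -> lipschitzv gradf L ->
  (exists lb : R, forall z, lb <= f z) ->
  closedv S -> convexv S -> (exists z, S z) ->
  (1 <= K)%N ->
  0 < etaL -> etaL <= etaH ->
  (forall k, (1 <= k)%N -> hermitianM (B k) /\ loewner_bounds etaL etaH (B k)) ->
  0 < amin -> amax < 2 * etaL / (etaL + L) ->
  (forall k, (1 <= k)%N -> amin <= alpha k <= amax) ->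
  GKSM A y gradf S K alpha B x V ->
  let F := fun z => hfun A y z + f z in
  let gradF := fun z => gradh A y z + gradf z in
  let FC := fun z => ((F z)%:E + indicator S z)%E in
  let ups := etaL / amax - (etaL + L) / 2 in
  (* (i) *)
  ((fun k => normv (x k.+1 - x k)) @ \oo --> (0 : R) /\
   forall xh, (forall (e : R) (n : nat), 0 < e ->
                 exists2 k, (n <= k)%N & normv (x k - xh) < e) ->
     exists2 v, subdiff (indicator S) xh v & gradF xh + v = 0)
  /\
  (* (ii) *)
  (forall (xs : 'cV[R[i]]_N) (c t eta Lam : R) (U : set 'cV[R[i]]_N),
     cvgv x xs ->
     0 < c -> 0 <= t < 1 -> 0 < eta -> 0 < Lam ->
     (forall z, normv (z - xs) <= Lam -> U z) ->
     KL_at FC xs eta U (fun s => c * s `^ (1 - t)) ->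
     let Fs := F xs in
     let gam := sup [set (c * (L * alpha k + etaH)) ^+ 2
                          / (ups * (1 - t) ^+ 2 * alpha k ^+ 2)
                    | k in [set k : nat | (1 <= k)%N]] in
     exists2 K' : nat, (K.+1 < K')%N &
       let FK := F (x K') - Fs in
       [/\ forall k, (K' <= k)%N ->
             normv (x k - xs) <= Lam /\ (`| FC (x k) - Fs%:E | < eta%:E)%E,
           t = 0 -> forall k, (K' <= k)%N ->
             F (x k.+1) - Fs <= Num.max (FK - gam^-1 * (k - K').+1%:R) 0,
           0 < t <= 2^-1 -> forall k, (K' <= k)%N ->
             F (x k.+1) - Fs <=
               (1 - FK `^ (2 * t - 1) / (FK `^ (2 * t - 1) + gam)) ^+ (k - K').+1
               * FK &
           2^-1 < t < 1 -> forall sigma : R, 0 < sigma < 1 ->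
             let q := (t - 2^-1) * (1 - sigma) `^ (2 * t) / gam in
             exists k0 : nat, forall k, (k0 <= k)%N -> (K' <= k)%N ->
               F (x k.+1) - Fs <=
                 (FK `^ (1 - 2 * t) + q * (k - K').+1%:R) `^ (1 / (1 - 2 * t))]).
Proof.
move=> _ f_grad L_gt0 gradf_lip f_lb S_closed S_convex _ _ etaL_gt0 etaLH B_bounds.
move=> amin_gt0 amax_lt alpha_bounds gksm F gradF FC ups; split; first split.
- exact: (gksm_step_cvg0 f_grad L_gt0 gradf_lip f_lb S_convex etaL_gt0 B_bounds
    amin_gt0 amax_lt alpha_bounds gksm).
- move=> xh xh_cluster; exists (- gradF xh); last exact: subrr.
  apply/frechet_subdiff_sub/normal_cone_sub_frechet.
  exact: (gksm_cluster_normal f_grad L_gt0 gradf_lip f_lb S_closed S_convex etaL_gt0 etaLH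
    B_bounds amin_gt0 amax_lt alpha_bounds gksm xh_cluster).
move=> xs c t eta Lam U x_cvg c_gt0 t01 eta_gt0 Lam_gt0 ballU F_KL Fs gam.
have [K' K'_gt [x_near [finite linear sublinear]]] :=
  gksm_KL_rates f_grad L_gt0 gradf_lip S_closed S_convex etaL_gt0 etaLH B_bounds
    amin_gt0 amax_lt alpha_bounds gksm x_cvg c_gt0 t01 eta_gt0 Lam_gt0 ballU F_KL.
by exists K'; first exact: ltnW.
Qed.
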